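(* Let $\mathcal X,\mathcal Y,\mathcal G,\mathcal H$ be Banach spaces with continuous embeddings $\mathcal X\subset\mathcal G$ and $\mathcal Y\subset\mathcal H\subset\mathcal G^*\subset\mathcal X^*$. Let $\mathcal U\subset\mathcal X$ be open, $\mathcal E:\mathcal U\to\mathbb R$ a $C^2$ function, and $x_\infty\in\mathcal U$ a critical point, $\mathcal E'(x_\infty)=0$. Let $\mathcal M:\mathcal U\to\mathcal Y$ be a $C^1$ gradient map for $\mathcal E$, and suppose $\mathcal E$ is Morse–Bott at $x_\infty$, so that $\mathcal U\cap\mathrm{Crit}\,\mathcal E$ is a relatively open smooth submanifold of $\mathcal X$ and $K:=\mathrm{Ker}\,\mathcal E''(x_\infty)=T_{x_\infty}\mathrm{Crit}\,\mathcal E$. Suppose that for each $x\in\mathcal U$ the bounded linear operator $\mathcal M'(x):\mathcal X\to\mathcal Y$ has an extension $\mathcal M_1(x):\mathcal G\to\mathcal H$ such that the map $\mathcal U\ni x\mapsto\mathcal M_1(x)\in\mathcal L(\mathcal G,\mathcal H)$ is continuous. Assume that $K$ has a closed complement $\mathcal X_0\subset\mathcal X$, that $\mathcal K:=\mathrm{Ker}\,\mathcal M_1(x_\infty)\subset\mathcal G$ has a closed complement $\mathcal G_0\subset\mathcal G$ with $\mathcal X_0\subset\mathcal G_0$, and that $\mathrm{Ran}\,\mathcal M_1(x_\infty)\subset\mathcal H$ is closed. Then there are constants $Z\in(0,\infty)$ and $\sigma\in(0,1]$ such that every $x\in\mathcal U$ with $\|x-x_\infty\|_{\mathcal X}<\sigma$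 satisfies $$\|\mathcal M(x)\|_{\mathcal H}\geq Z\,|\mathcal E(x)-\mathcal E(x_\infty)|^{1/2}.$$
   Context: Gradient map: if $\mathcal U\subset\mathcal X$ is open and $\mathcal Y\subset\mathcal X^*$ is a Banach space continuously embedded, a continuous map $\mathcal M:\mathcal U\to\mathcal Y$ is a gradient map for a $C^1$ function $\mathcal E:\mathcal U\to\mathbb R$ if $\mathcal E'(x)v=\langle v,\mathcal M(x)\rangle_{\mathcal X\times\mathcal X^*}$ for all $x\in\mathcal U$, $v\in\mathcal X$. $\mathrm{Crit}\,\mathcal E=\{x:\mathcal E'(x)=0\}$, and $\mathcal E''(x):\mathcal X\to\mathcal X^*$ is the Hessian. A $C^2$ function $\mathcal E$ is Morse–Bott at $x_0$ if there is an open neighborhood $\mathcal U$ of $x_0$ such that $\mathcal U\cap\mathrm{Crit}\,\mathcal E$ is a relatively open smooth submanifold and $T_{x_0}\mathrm{Crit}\,\mathcal E=\mathrm{Ker}\,\mathcal E''(x_0)$. $\mathcal L(\mathcal G,\mathcal H)$ is the Banach space of bounded linear operators. *)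

(* Defs.v *)
From HB Require Import structures.
From mathcomp Require Import all_boot all_order all_algebra.
From mathcomp Require Import all_classical all_reals all_analysis.

Set Implicit Arguments.
Unset Strict Implicit.
Unset Printing Implicit Defensive.

Import Order.TTheory GRing.Theory Num.Theory.
Import numFieldNormedType.Exports.
Local Open Scope classical_set_scope.
Local Open Scope ring_scope.

Section Defs.
Variable R : realType.

Definition bounded_linear (V W : normedModType R) (f : V -> W) : Prop :=
  (forall (a : R) (u v : V), f (a *: u + v) = a *: f u + f v) /\
  exists C : R, forall v, `|f v| <= C * `|v|.

Definition embedding (V W : normedModType R) (f : V -> W) : Prop :=
  bounded_linear f /\ injective f.

Definition bounded_bilinear (V : normedModType R) (B : V -> V -> R) : Prop :=
  (forall u, bounded_linear (B u)) /\
  (forall (a : R) (u w v : V), B (a *: u + w) v = a * B u v + B w v) /\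
  exists C : R, forall u v, `|B u v| <= C * `|u| * `|v|.

Definition closed_subspace (V : normedModType R) (S : set V) : Prop :=
  S 0 /\ (forall (a : R) (u v : V), S u -> S v -> S (a *: u + v)) /\ closed S.

Definition closed_complement (V : normedModType R) (S T : set V) : Prop :=
  closed_subspace T /\ (forall v, S v -> T v -> v = 0) /\
  (forall v, exists s t, S s /\ T t /\ v = s + t).

Definition opcont_on (V A W : normedModType R) (U : set V) (F : V -> A -> W) : Prop :=
  forall x, U x -> forall e : R, 0 < e -> exists d : R, 0 < d /\
    forall y, U y -> `|y - x| < d -> forall v, `|F y v - F x v| <= e * `|v|.

(* D x is the Frechet derivative at x of the X^*-valued map F, for x in U *)
Definition bil_deriv_on (V : normedModType R) (U : set V) (F : V -> V -> R)
    (D : V -> V -> V -> R) : Prop :=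
  forall x, U x -> forall e : R, 0 < e -> exists d : R, 0 < d /\
    forall h, `|h| < d -> forall v,
      `|F (x + h) v - F x v - D x h v| <= e * `|h| * `|v|.

Definition bil_cont_on (V : normedModType R) (U : set V) (D : V -> V -> V -> R) : Prop :=
  forall x, U x -> forall e : R, 0 < e -> exists d : R, 0 < d /\
    forall y, U y -> `|y - x| < d -> forall h v, `|D y h v - D x h v| <= e * `|h| * `|v|.

Definition setv (V : Type) (v : nat -> V) (i : nat) (u : V) : nat -> V :=
  fun j => if j == i then u else v j.
Definition consv (V : Type) (h : V) (v : nat -> V) : nat -> V :=
  fun n => if n is n'.+1 then v n' else h.
Definition pnorm (V : normedModType R) (k : nat) (v : nat -> V) : R :=
  \prod_(i < k) `|v i|.

(* A is a bounded k-linear map in its first k arguments (and ignores the others) *)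
Definition multilinear_bounded (V W : normedModType R) (k : nat)
    (A : (nat -> V) -> W) : Prop :=
  (forall v v', (forall i, (i < k)%N -> v i = v' i) -> A v = A v') /\
  (forall i, (i < k)%N -> forall v (a : R) (u w : V),
      A (setv v i (a *: u + w)) = a *: A (setv v i u) + A (setv v i w)) /\
  exists C : R, forall v, `|A v| <= C * pnorm k v.

(* f is C^infinity on the (open) set S: D k x is the k-th Frechet derivative *)
Definition smooth_on (V W : normedModType R) (S : set V) (f : V -> W) : Prop :=
  exists D : nat -> V -> (nat -> V) -> W,
    (forall x v, D 0%N x v = f x) /\
    (forall k x, S x -> multilinear_bounded k (D k x)) /\
    (forall k x, S x -> forall e : R, 0 < e -> exists d : R, 0 < d /\
       forall h, `|h| < d -> forall v,
         `|D k (x + h) v - D k x v - D k.+1 x (consv h v)| <= e * `|h| * pnorm k v).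

(* embedded smooth submanifold of a Banach space (Lang): locally, after a
   smooth diffeomorphism, S is a closed split linear subspace *)
Definition submanifold (V : normedModType R) (S : set V) : Prop :=
  forall p, S p -> exists (O : set V) (phi psi : V -> V) (F : set V),
    [/\ open O, O p, smooth_on O phi, open (phi @` O) & smooth_on (phi @` O) psi] /\
    (forall x, O x -> psi (phi x) = x) /\ (forall y, (phi @` O) y -> phi (psi y) = y) /\
    closed_subspace F /\ (exists F', closed_complement F F') /\
    phi @` (O `&` S) = (phi @` O) `&` F.

Definition tangent_space (V : normedModType R) (S : set V) (p : V) : set V :=
  [set v | exists (e : R) (g : R^o -> V), [/\ 0 < e, g 0 = p,
     (forall t : R, `|t| < e -> S (g t)) & is_derive (0 : R^o) (1 : R^o) g v]].

End Defs.

(* Main.v *)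
Require Import Defs.
From HB Require Import structures.
From mathcomp Require Import all_boot all_order all_algebra.
From mathcomp Require Import all_classical all_reals all_analysis.
From mathcomp Require Import lra ring.
Import Order.TTheory GRing.Theory Num.Theory.
Import numFieldNormedType.Exports.
Local Open Scope classical_set_scope.
Local Open Scope ring_scope.

(* Near [xinf] every [x] can be written [y + w] with [y] critical, [w] in [X0]
   and [E y = E xinf]: a submanifold chart at [xinf], projected onto the tangent
   space [K] along [X0], gives a perturbation of the identity of [K], whose
   fixed-point equation is solved by contraction. By the closed graph theorem
   [M1 xinf] is bounded below on [G0]; since [M1] is continuous and [M y] is
   zero, [|M x|_H] is comparable to [|w|_G]. Integrating the gradient from [y] to
   [x] gives [|E x - E y| <= C |w|_G ^ 2], whence the inequality. *)

(** The lower bound for [M1 xinf] holds only on [G0] and in the norm of [G], so the sizes of [M x]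
    and [E x] are measured by [iXG w], never by the norm of [w] in [X]. This is why the
    linearization uses [M1], continuous as a map into operators from [G] to [H], in place of the
    derivative of [M], and why [w] must lie exactly in [X0], which is sent into [G0]. The fibres of
    a chart need not follow [X0], hence an equation to solve for [y]. The equality of [E y] and
    [E xinf] comes from a path of critical points: the image of a straight segment under the inverse
    chart. *)

Section bounded_linear.
Context {R : realType} {V W : normedModType R} (f : V -> W).
Hypothesis bf : bounded_linear f.

Lemma bounded_linear0 : f 0 = 0.
Proof.
have := bf.1 1 0 0; rewrite scaler0 add0r scale1r => /(congr1 (fun z => z - f 0)).
by rewrite subrr addrK.
Qed.

Lemma bounded_linearZ (a : R) u : f (a *: u) = a *: f u.
Proof. by rewrite -[a *: u]addr0 bf.1 bounded_linear0 addr0. Qed.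

Lemma bounded_linearD u v : f (u + v) = f u + f v.
Proof. by rewrite -[u]scale1r bf.1 !scale1r. Qed.

Lemma bounded_linearB u v : f (u - v) = f u - f v.
Proof. by rewrite addrC -scaleN1r bf.1 scaleN1r addrC. Qed.

Lemma bounded_linear_pos : exists2 C, 0 < C & forall v, `|f v| <= C * `|v|.
Proof.
have [_ [C fC]] := bf; exists (`|C| + 1); first by rewrite ltr_wpDl.
move=> v; rewrite (le_trans (fC v))// ler_wpM2r//.
by rewrite (le_trans (ler_norm _))// lerDl.
Qed.

Lemma bounded_linear_cvg (u : nat -> V) x :
  u @ \oo --> x -> f \o u @ \oo --> f x.
Proof.
move=> /cvgrPdist_le ux; have [C C0 fC] := bounded_linear_pos.
apply/cvgrPdist_le => e e0; have /ux : 0 < e / C by rewrite divr_gt0.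
apply: filterS => n xn /=; rewrite -bounded_linearB (le_trans (fC _))//.
by rewrite mulrC -ler_pdivlMr.
Qed.

End bounded_linear.

Section closed_subspace.
Context {R : realType} {V : normedModType R} (S : set V).
Hypothesis cS : closed_subspace S.

Lemma closed_subspaceZ (a : R) u : S u -> S (a *: u).
Proof. by move=> Su; rewrite -(addr0 (a *: u)); apply: cS.2.1 => //; exact: cS.1. Qed.

Lemma closed_subspaceD u v : S u -> S v -> S (u + v).
Proof. by move=> Su Sv; rewrite -(scale1r u); exact: cS.2.1. Qed.

Lemma closed_subspaceB u v : S u -> S v -> S (u - v).
Proof. by move=> Su Sv; rewrite addrC -scaleN1r; exact: cS.2.1. Qed.

Lemma closed_subspace_cvg (u : nat -> V) x :
  (forall n, S (u n)) -> u @ \oo --> x -> S x.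
Proof. by move=> Su; apply: closed_cvg cS.2.2 _ _; exact: nearW. Qed.

End closed_subspace.

(** * Sequences with a controlled rate of convergence *)

Lemma cvg_cauchy_rate {R : realType} (V : completeNormedModType R)
    (u : nat -> V) (r : nat -> R) :
  r @ \oo --> 0 -> (forall n m, (n <= m)%N -> `|u m - u n| <= r n) ->
  exists l, u @ \oo --> l /\ forall n, `|l - u n| <= r n.
Proof.
move=> r0 ur.
have /cauchy_cvgP/cvg_ex[/= l ul] : cauchy (u @ \oo).
  apply: cauchy_exP => e e0.
  have [N _ /(_ N (leqnn N)) rN] := (@cvgrPdist_lt _ _ _ _ _ r 0).1 r0 e e0.
  exists (u N), N => // n /= Nn; rewrite -ball_normE /= distrC.
  by rewrite (le_lt_trans (ur _ _ Nn))// (le_lt_trans _ rN)// sub0r normrN ler_norm.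
exists l; split=> // n.
have ul' : `|u m - u n| @[m --> \oo] --> `|l - u n|.
  by apply: cvg_norm; apply: cvgB => //; exact: cvg_cst.
apply: (closed_cvg (fun x => x <= r n) _ _ _ ul'); first exact: closed_le.
by exists n => // m /= nm; exact: ur.
Qed.

Lemma cvg_half_pow (R : realType) (c : R) : (c * 2^-1 ^+ n) @[n --> \oo] --> 0.
Proof.
apply: (@cvg_geometric R c 2^-1).
by rewrite ger0_norm ?invr_ge0// invf_lt1 ?ltr1n.
Qed.

Lemma cvg_half_step {R : realType} (V : completeNormedModType R)
    (u : nat -> V) (c : R) :
  (forall n, `|u n.+1 - u n| <= c * 2^-1 ^+ n) ->
  exists l, u @ \oo --> l /\ forall n, `|l - u n| <= 2 * c * 2^-1 ^+ n.
Proof.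
move=> uc; apply: cvg_cauchy_rate; first exact: cvg_half_pow.
move=> n m /subnKC <-; move: (m - n)%N => k {m}.
have c0 : 0 <= c by have := le_trans (normr_ge0 _) (uc 0%N); rewrite expr0 mulr1.
(* The exact geometric partial sum lets the induction on [k] close; dropping its subtracted term
   gives the claim. *)
suff H : `|u (n + k)%N - u n| <= 2 * c * (2^-1 ^+ n - 2^-1 ^+ (n + k)).
  rewrite (le_trans H)// ler_wpM2l ?mulr_ge0// lerBlDr lerDl.
  by rewrite exprn_ge0// invr_ge0.
elim: k => [|k ih]; first by rewrite addn0 !subrr normr0 mulr0.
rewrite addnS (le_trans (ler_distD (u (n + k)%N) _ _))//.
have := uc (n + k)%N; move: ih; rewrite exprS.
set a := `|_|; set b := `|_|; set x := _ ^+ n; set y := _ ^+ _.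
by move=> ha hb; lra.
Qed.

(** * The closed graph theorem for a map given on a closed subspace *)

Section closed_graph.
Context {R : realType} {V W : completeNormedModType R}.
Variables (D : set V) (f : V -> W).
Hypothesis D_closed : closed_subspace D.
Hypothesis f_linear : forall (a : R) u v, D u -> D v ->
  f (a *: u + v) = a *: f u + f v.

Let D0 : D 0 := D_closed.1.
Let DB u v := @closed_subspaceB _ _ _ D_closed u v.
Let DD u v := @closed_subspaceD _ _ _ D_closed u v.
Let DZ (a : R) u := @closed_subspaceZ _ _ _ D_closed a u.
Let fB u v : D u -> D v -> f (u - v) = f u - f v.
Proof.
by move=> Du Dv; rewrite addrC -scaleN1r f_linear// scaleN1r addrC.
Qed.
Let f0 : f 0 = 0.
Proof. by rewrite -(subrr (0 : V)) fB// subrr. Qed.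
Let fZ (a : R) u : D u -> f (a *: u) = a *: f u.
Proof. by move=> Du; rewrite -(addr0 (a *: u)) f_linear// f0 addr0. Qed.

(* Baire's theorem inside the closed set [D]: were no [|f| <= n] dense in a ball
   of [D], nested balls avoiding these sets would meet at a point of [D]. *)
Lemma somewhere_dense_sublevel : exists (n : nat) (x : V) (r : R),
  [/\ D x, 0 < r & forall y, D y -> `|y - x| < r -> forall e, 0 < e ->
    exists z, [/\ D z, `|z - y| < e & `|f z| <= n%:R]].
Proof.
apply: contrapT => /forallNP nodense.
(* A state is a level with the centre and radius of a ball; the next closed ball lies inside the
   previous one and misses the current sublevel. *)
have next (s : nat * (V * R)) : {s' : nat * (V * R) | D s.2.1 -> 0 < s.2.2 ->
    [/\ s'.1 = s.1.+1, D s'.2.1, 0 < s'.2.2 <= s.2.2 / 2,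
      `|s'.2.1 - s.2.1| + s'.2.2 <= s.2.2 &
      forall z, D z -> `|z - s'.2.1| <= s'.2.2 -> s.1%:R < `|f z|]}.
  apply: cid; case: s => n [x r] /=.
  have [Dx|] := pselect (D x); last by exists (n, (x, r)).
  have [r0|] := pselect (0 < r); last by exists (n, (x, r)).
  have : exists y e, [/\ D y, `|y - x| < r / 2, 0 < e &
      forall z, D z -> `|z - y| < e -> n%:R < `|f z|].
    apply: contrapT => H; apply: (nodense n); exists x, (r / 2).
    split=> //; first by rewrite divr_gt0.
    move=> y Dy yx e e0; apply: contrapT => Hz; apply: H; exists y, e.
    split=> // z Dz ze; rewrite ltNge; apply/negP => fz; apply: Hz.
    by exists z.
  move=> [y [e [Dy yx e0 ye]]].
  (* [e / 2] makes the closed ball fit in the open one that misses the sublevel; [r / 2] leaves room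
     for nesting and drives the radii to 0. *)
  exists (n.+1, (y, Num.min (e / 2) (r / 2))) => _ _ /=; split=> //.
  - by rewrite lt_min !divr_gt0//= ge_min lexx orbT.
  - have : Num.min (e / 2) (r / 2) <= r / 2 by rewrite ge_min lexx orbT.
    by move: yx => /ltW; set a := `|_|; set b := Num.min _ _ => ? ?; lra.
  - move=> z Dz zy; apply: ye => //; rewrite (le_lt_trans zy)//.
    by rewrite gt_min ltr_pdivrMr// ltr_pMr// ltr1n.
have [s [s0 ss]] := dependent_choice next (0%N, (0, 1)).
have sP n : [/\ (s n).1 = n, D (s n).2.1 & 0 < (s n).2.2].
  elim: n => [|n [sn Dn rn]]; first by rewrite s0.
  by have [-> ? /andP[? _] _ _] := ss n Dn rn; rewrite sn.
have sS n : [/\ (s n.+1).2.2 <= (s n).2.2 / 2,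
      `|(s n.+1).2.1 - (s n).2.1| + (s n.+1).2.2 <= (s n).2.2 &
      forall z, D z -> `|z - (s n.+1).2.1| <= (s n.+1).2.2 -> n%:R < `|f z|].
  by have [sn Dn rn] := sP n; have [_ _ /andP[_ ?] ?] := ss n Dn rn; rewrite sn.
have [l [sl lr]] : exists l, (fun n => (s n).2.1) @ \oo --> l /\
    forall n, `|l - (s n).2.1| <= (s n).2.2.
  apply: cvg_cauchy_rate.
    apply: (@squeeze_cvgr _ _ _ _ (fun=> 0) (fun n => 1 * 2^-1 ^+ n)).
    - apply: nearW => n; have [_ _ /ltW ->] := sP n; rewrite andTb.
      elim: n => [|n ih]; first by rewrite s0 mul1r.
      have [H _ _] := sS n; rewrite (le_trans H)// exprSr mulrA.
      by rewrite ler_wpM2r.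
    - exact: cvg_cst.
    - exact: cvg_half_pow.
  move=> n m nm; suff : `|(s m).2.1 - (s n).2.1| + (s m).2.2 <= (s n).2.2.
    by apply: le_trans; rewrite lerDl ltW//; have [] := sP m.
  move: nm => /subnKC <-; elim: (m - n)%N => [|k ih].
    by rewrite addn0 subrr normr0 add0r.
  have [_ H _] := sS (n + k)%N; rewrite addnS.
  apply: le_trans ih; apply: (le_trans _ (lerD (lexx _) H)).
  by rewrite addrA lerD2r addrC ler_distD.
have Dl : D l.
  apply: (closed_cvg D D_closed.2.2 _ _ sl).
  by apply: nearW => n; have [] := sP n.
(* The limit lies in every ball, so [|f l|] would exceed the first integer above itself. *)
have [_ _ Hn] := sS (Num.truncn `|f l|).+1.
have := Hn l Dl (lr _); apply/negP; rewrite -leNgt ltW//.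
exact: truncnS_gt.
Qed.

(** Subtracting approximants of [x0] from approximants of [x0 + x] moves the ball of density to the
    origin and doubles the bound; homogeneity then reaches every [x]. *)
Lemma bounded_image_approximation : exists2 C, 0 < C & forall x, D x -> forall e, 0 < e ->
  exists z, [/\ D z, `|x - z| <= e & `|f z| <= C * `|x|].
Proof.
have [n [x0 [r [Dx0 r0 Hd]]]] := somewhere_dense_sublevel.
have near0 x : D x -> `|x| < r -> forall e, 0 < e ->
    exists z, [/\ D z, `|x - z| <= e & `|f z| <= 2 * n%:R].
  move=> Dx xr e e0.
  have e2 : 0 < e / 2 by rewrite divr_gt0.
  have [||a [Da ax fa]] := Hd (x0 + x) _ _ _ e2; first exact: DD.
    by rewrite addrC addKr.
  have [||b [Db bx fb]] := Hd x0 _ _ _ e2 => //; first by rewrite subrr normr0.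
  exists (a - b); split; first exact: DB.
    have -> : x - (a - b) = (b - x0) - (a - (x0 + x)).
      by rewrite !opprB -[x0 + x - a]addrA [RHS]addrA subrK addrCA.
    rewrite (le_trans (ler_normB _ _))// (_ : e = e / 2 + e / 2); last by lra.
    by rewrite lerD// ltW.
  by rewrite fB// (le_trans (ler_normB _ _))// mulr2n mulrDl mul1r lerD.
(* The level [2 * n%:R] divided by [r / 2], the norm to which [x] is rescaled; [+ 1] keeps the
   constant positive when [n] is 0. *)
exists (4 * n%:R / r + 1); first by rewrite ltr_wpDl// divr_ge0// ?mulr_ge0// ltW.
move=> x Dx e e0; have [->|x_neq0] := eqVneq x 0.
  by exists 0; rewrite subrr f0 !normr0 mulr0 lexx (ltW e0).
have nx : 0 < `|x| by rewrite normr_gt0.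
pose a := r / 2 / `|x|.
have a0 : 0 < a by rewrite !divr_gt0.
have [|||z [Dz zx fz]] := near0 (a *: x) _ _ (a * e); first exact: DZ.
- by rewrite normrZ gtr0_norm// divfK ?gt_eqF// ltr_pdivrMr// ltr_pMr// ltr1n.
- by rewrite mulr_gt0.
exists (a^-1 *: z); split; first exact: DZ.
  rewrite -[x]scale1r -(mulVf (lt0r_neq0 a0)) -scalerA -scalerBr normrZ.
  by rewrite gtr0_norm ?invr_gt0// ler_pdivrMl.
rewrite fZ// normrZ gtr0_norm ?invr_gt0// ler_pdivrMl// (le_trans fz)//.
rewrite /a mulrCA divfK ?gt_eqF//.
rewrite [leRHS]mulrDl.
have -> : 4 * n%:R / r * (r / 2) = 2 * n%:R :> R by field; rewrite gt_eqF.
by rewrite mul1r lerDl divr_ge0// ltW.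
Qed.

(** Approximating the remaining error again and again writes [x] as a series whose images are
    bounded by [C * |x| * 2^-1 ^+ n]. The images of the partial sums converge by completeness of
    [W], and the closed graph identifies their limit with [f x]; summing gives the factor 2. *)
Theorem closed_graph :
  (forall (u : nat -> V) x y, (forall n, D (u n)) -> u @ \oo --> x ->
    f \o u @ \oo --> y -> f x = y) ->
  exists2 C, 0 < C & forall x, D x -> `|f x| <= C * `|x|.
Proof.
move=> graphP; have [C C0 HC] := bounded_image_approximation.
exists (2 * C); first by rewrite mulr_gt0.
move=> x Dx; have [->|x_neq0] := eqVneq x 0; first by rewrite f0 !normr0 mulr0.
have nx : 0 < `|x| by rewrite normr_gt0.
pose e n := `|x| * 2^-1 ^+ n.
have e0 n : 0 < e n by rewrite mulr_gt0 ?exprn_gt0 ?invr_gt0.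
have next (s : nat * V) : {s' : nat * V | D s.2 ->
    [/\ s'.1 = s.1.+1, D s'.2, `|x - s'.2| <= e s'.1 &
       `|f (s'.2 - s.2)| <= C * `|x - s.2|]}.
  apply: cid; case: s => n s /=.
  have [Ds|] := pselect (D s); last by exists (0%N, 0).
  have [z [Dz zx fz]] := HC (x - s) (DB _ _ Dx Ds) _ (e0 n.+1).
  exists (n.+1, s + z) => _ /=; split=> //; first exact: DD.
    by rewrite opprD addrA.
  by rewrite addrC addKr.
have [s [s0 ss]] := dependent_choice next (0%N, 0).
have sP n : [/\ (s n).1 = n, D (s n).2 & `|x - (s n).2| <= e n].
  elim: n => [|n [sn Dn rn]].
    by rewrite s0 /= subr0 /e expr0 mulr1.
  by have [+ ? + _] := ss n Dn => sn1; rewrite sn1 sn.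
have [|y [sy yb]] := @cvg_half_step R W (fun n => f (s n).2) (C * `|x|).
  move=> n; have [_ Dn rn] := sP n; have [_ Dn1 _ H] := ss n Dn.
  by rewrite -fB// (le_trans H)// -mulrA ler_wpM2l// ltW.
have -> : f x = y.
  apply: (graphP (fun n => (s n).2)) => //; first by move=> n; have [] := sP n.
  apply/cvgrPdist_le => d d0.
  have [N _ HN] := (@cvgrPdist_le _ _ _ _ _ _ 0).1 (@cvg_half_pow R `|x|) d d0.
  exists N => // n /= /HN /=; rewrite sub0r normrN gtr0_norm; last exact: e0.
  by apply: le_trans; have [] := sP n.
have := yb 0%N; rewrite s0 /= f0 subr0 expr0 mulr1 => /le_trans; apply.
by rewrite mulrA.
Qed.

End closed_graph.

(** * Frechet derivatives, a common form for ['d], [is_derive] and the first order of [smooth_on] *)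

Definition has_frechet {R : realType} {V W : normedModType R} (F : V -> W) (x : V)
    (L : V -> W) : Prop :=
  bounded_linear L /\
  forall e : R, 0 < e -> exists d : R, 0 < d /\
    forall h, `|h| < d -> `|F (x + h) - F x - L h| <= e * `|h|.

(* A supremum argument replaces the usual reduction to real-valued functions,
   which would need the Hahn-Banach theorem. *)
Lemma locally_lipschitz_le {R : realType} {W : normedModType R} (f : R -> W) (C : R) :
  (forall t, 0 <= t <= 1 -> exists d : R, 0 < d /\
    forall s, 0 <= s <= 1 -> `|s - t| < d -> `|f s - f t| <= C * `|s - t|) ->
  `|f 1 - f 0| <= C.
Proof.
move=> loc.
pose A := [set t : R | 0 <= t <= 1 /\ `|f t - f 0| <= C * t].
have A0 : A 0 by rewrite /A /= lexx ler01 subrr normr0 mulr0.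
have A1 : ubound A 1 by move=> t [/andP[]].
have supA : has_sup A by split; [exists 0|exists 1].
have s01 : 0 <= sup A <= 1.
  by rewrite ge_sup ?andbT//; [apply: ub_le_sup => //; case: supA|exists 0].
have [d [d0 Hd]] := loc _ s01.
have As : A (sup A).
  have [t At st] := sup_adherent d0 supA.
  have ts : t <= sup A by apply: ub_le_sup => //; case: supA.
  have [t01 ft] := At; split=> //.
  rewrite (le_trans (ler_distD (f t) _ _))// (_ : C * sup A = C * (sup A - t) + C * t).
    rewrite lerD// distrC -[X in _ <= C * X]ger0_norm ?subr_ge0//.
    rewrite [X in _ <= C * X]distrC; apply: Hd => //.
    by rewrite distrC ger0_norm ?subr_ge0// ltrBlDr addrC -ltrBlDr.
  by rewrite -mulrDr subrK.
suff s1 : sup A = 1 by have [_] := As; rewrite s1 mulr1.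
apply/eqP; rewrite eq_le (andP s01).2 /= leNgt; apply/negP => s1.
(* Were the supremum below 1, the local estimate there would put this larger point in [A]. *)
pose t := Num.min 1 (sup A + d / 2).
have st : sup A < t by rewrite lt_min s1 ltrDl divr_gt0.
have t1 : t <= 1 by rewrite ge_min lexx.
have td : t <= sup A + d / 2 by rewrite ge_min lexx orbT.
have t01 : 0 <= t <= 1 by rewrite t1 (le_trans _ (ltW st)) ?(andP s01).1.
suff : A t by move/(ub_le_sup supA.2); rewrite leNgt st.
split=> //; rewrite (le_trans (ler_distD (f (sup A)) _ _))//.
rewrite (_ : C * t = C * (t - sup A) + C * sup A); last by rewrite -mulrDr subrK.
rewrite lerD//; last by case: As.
rewrite -[X in _ <= C * X]gtr0_norm ?subr_gt0//.
apply: Hd => //; rewrite gtr0_norm ?subr_gt0//; lra.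
Qed.

(** The free vector [l] covers three uses: a reference derivative applied to [h] gives linearization
    errors, [l = 0] bounds increments, and [C = 0] as well gives constancy. *)
Lemma mean_value_segment {R : realType} {V W : normedModType R} (F : V -> W)
    (DF : V -> V -> W) (a h : V) (l : W) (C : R) :
  (forall t : R, 0 <= t <= 1 -> has_frechet F (a + t *: h) (DF (a + t *: h))) ->
  (forall t : R, 0 <= t <= 1 -> `|DF (a + t *: h) h - l| <= C) ->
  `|F (a + h) - F a - l| <= C.
Proof.
move=> dF bF; apply/ler_addgt0Pr => e e0.
pose f (t : R) := F (a + t *: h) - t *: l.
have -> : F (a + h) - F a - l = f 1 - f 0.
  by rewrite /f !scale1r !scale0r addr0 subr0 addrAC.
apply: locally_lipschitz_le => t t01.
have [DFl dFt] := dF t t01.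
have h1 : 0 < `|h| + 1 by rewrite ltr_wpDl.
(* The slack [e] absorbs the Frechet remainder; [|h| + 1] avoids a division by zero. *)
have [|d [d0 Hd]] := dFt (e / (`|h| + 1)); first by rewrite divr_gt0.
exists (d / (`|h| + 1)); split; first by rewrite divr_gt0.
move=> s s01 st; rewrite /f.
have -> : a + s *: h = a + t *: h + (s - t) *: h.
  by rewrite -addrA -scalerDl [t + _]addrC subrK.
set z := a + t *: h.
have -> : F (z + (s - t) *: h) - s *: l - (F z - t *: l) =
    F (z + (s - t) *: h) - F z - DF z ((s - t) *: h) + (s - t) *: (DF z h - l).
  rewrite (bounded_linearZ _ DFl) scalerBr [RHS]addrA subrK [(s - t) *: l]scalerBl !opprB.
  by rewrite addrACA [RHS]addrACA [- F z - _]addrC.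
have hs : `|(s - t) *: h| < d.
  rewrite normrZ (@le_lt_trans _ _ (`|s - t| * (`|h| + 1)))//.
    by rewrite ler_wpM2l// lerDl.
  by rewrite -ltr_pdivlMr.
rewrite (le_trans (ler_normD _ _))// mulrDl addrC lerD//.
  by rewrite normrZ mulrC ler_wpM2r// bF.
rewrite (le_trans (Hd _ hs))// normrZ mulrAC ler_pdivrMr// -!mulrA ler_wpM2l// ?(ltW e0)//.
by rewrite ler_wpM2l// lerDl.
Qed.

Lemma has_frechet_diff {R : realType} {V W : normedModType R} (F : V -> W) (x : V) :
  differentiable F x -> has_frechet F x ('d F x).
Proof.
move=> dF; split=> [|e e0].
  split; first exact: linearP.
  have [C _ HC] := linear_lipschitz (diff_continuous dF).
  by exists C.
have /eqaddoP Ho := diff_locally dF.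
have /nbhs_normP[d /= d0 Hd] := Ho e e0.
exists d; split=> // h hd; have := Hd h; rewrite /= sub0r normrN => /(_ hd).
by rewrite [_ (F \o _) _]/= [x + h]addrC opprD addrA; apply: le_trans.
Qed.

Lemma has_frechet_derive {R : realType} {V : normedModType R} {g : R^o -> V}
    {x : R^o} {v : V} :
  is_derive x (1 : R^o) g v -> has_frechet g x (fun t : R^o => t *: v).
Proof.
move=> dg; split=> [|e e0].
  split; first by move=> a s t; rewrite scalerDl scalerA.
  by exists `|v| => t; rewrite normrZ mulrC.
have /eqaddoP Ho := derivable_nbhs (@ex_derive _ _ _ _ _ _ _ dg).
have /nbhs_normP[d /= d0 Hd] := Ho e e0.
exists d; split=> // h hd; have := Hd h; rewrite /= sub0r normrN => /(_ hd).
rewrite derive_val (_ : x + h = h%:A + x); last by rewrite [h%:A]mulr1 addrC.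
by move=> {}Hd; rewrite -addrA -opprD.
Qed.

Lemma has_frechet_linear {R : realType} {V W : normedModType R} (F : V -> W) (x : V) :
  bounded_linear F -> has_frechet F x F.
Proof.
move=> bF; split=> // e e0; exists 1; split=> // h _.
by rewrite bounded_linearD// addrAC addrK subrr normr0 mulr_ge0// ltW.
Qed.

Lemma has_frechet_comp {R : realType} {V W Z : normedModType R}
    {F : V -> W} {G : W -> Z} {x : V} {L : V -> W} {M : W -> Z} :
  has_frechet F x L -> has_frechet G (F x) M -> has_frechet (G \o F) x (M \o L).
Proof.
move=> [bL dF] [bM dG]; have [CL CL0 LC] := bounded_linear_pos _ bL.
have [CM CM0 MC] := bounded_linear_pos _ bM.
split=> [|e e0].
  split; first by move=> a u v /=; rewrite bL.1 bM.1.
  exists (CM * CL) => v /=; rewrite (le_trans (MC _))// -mulrA.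
  by rewrite ler_wpM2l// ltW.
have CL1 : 0 < CL + 1 by rewrite ltr_wpDl// ltW.
have [|d1 [d10 H1]] := dG (e / 2 / (CL + 1)); first by rewrite !divr_gt0.
have [|d2 [d20 H2]] := dF (Num.min 1 (e / 2 / CM)).
  by rewrite lt_min ltr01 !divr_gt0.
exists (Num.min d2 (d1 / (CL + 1))); split.
  by rewrite lt_min d20 divr_gt0.
move=> h; rewrite lt_min => /andP[hd2 hd1] /=.
have hF := H2 h hd2; set k := F (x + h) - F x.
have kb : `|k| <= (CL + 1) * `|h|.
  rewrite -[k](subrK (L h)) addrC mulrDl (le_trans (ler_normD _ _))// lerD//.
  by rewrite (le_trans hF)// ler_wpM2r// ge_min lexx.
have -> : F (x + h) = F x + k by rewrite [RHS]addrC subrK.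
have -> : G (F x + k) - G (F x) - M (L h) =
   G (F x + k) - G (F x) - M k + M (k - L h).
  by rewrite (bounded_linearB _ bM k (L h)) [RHS]addrA subrK.
rewrite (le_trans (ler_normD _ _))// [e in leRHS]splitr mulrDl lerD//.
  rewrite (le_trans (H1 _ _))//.
    by rewrite (le_lt_trans kb)// mulrC -ltr_pdivlMr.
  by rewrite -mulrA ler_wpM2l ?divr_ge0 ?(ltW e0)// ler_pdivrMl.
rewrite (le_trans (MC _))// -ler_pdivlMl// (le_trans hF)//.
by rewrite mulrA ler_wpM2r// mulrC ge_min lexx orbT.
Qed.

Lemma has_frechet_near {R : realType} {V W : normedModType R} (F G : V -> W)
    (x : V) (L : V -> W) :
  (\forall y \near x, F y = G y) -> has_frechet F x L -> has_frechet G x L.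
Proof.
move=> FG; have FGx := nbhs_singleton FG; move: FG.
move=> /nbhs_normP[d /= d0 FG] [bL dF]; split=> // e e0.
have [d' [d'0 H]] := dF e e0; exists (Num.min d d'); split.
  by rewrite lt_min d0.
move=> h; rewrite lt_min => /andP[hd hd'].
rewrite -FGx -FG; first exact: H.
by rewrite /= opprD addNKr normrN.
Qed.

Lemma has_frechet_unique {R : realType} {V W : normedModType R} {F : V -> W}
    {x : V} {L M : V -> W} :
  has_frechet F x L -> has_frechet F x M -> L =1 M.
Proof.
move=> [bL dL] [bM dM] h; apply/eqP; rewrite -subr_eq0 -normr_le0.
apply/ler_addgt0Pr => e e0; rewrite add0r.
have h1 : 0 < `|h| + 1 by rewrite ltr_wpDl.
pose c := e / 2 / (`|h| + 1).
have c0 : 0 < c by rewrite !divr_gt0.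
have [d1 [d10 H1]] := dL c c0; have [d2 [d20 H2]] := dM c c0.
pose t := Num.min d1 d2 / 2 / (`|h| + 1).
have t0 : 0 < t by rewrite !divr_gt0// lt_min d10.
have : `|t *: h| < Num.min d1 d2.
  rewrite normrZ gtr0_norm// (@le_lt_trans _ _ (t * (`|h| + 1)))//.
    by rewrite ler_wpM2l ?lerDl// ltW.
  by rewrite /t divfK ?gt_eqF// ltr_pdivrMr// ltr_pMr ?ltr1n// lt_min d10.
rewrite lt_min => /andP[/H1 {}H1 /H2 {}H2].
rewrite -(ler_pM2l t0) -{1}(gtr0_norm t0) -normrZ scalerBr.
rewrite -(bounded_linearZ _ bL) -(bounded_linearZ _ bM).
have -> : L (t *: h) - M (t *: h) = (F (x + t *: h) - F x - M (t *: h)) -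
   (F (x + t *: h) - F x - L (t *: h)) by rewrite opprB [RHS]addrC addrA subrK.
rewrite (le_trans (ler_normB _ _))// (le_trans (lerD H2 H1))//.
rewrite -mulr2n -mulr_natr normrZ gtr0_norm// [leLHS](_ : _ = t * (c * 2 * `|h|)).
  rewrite ler_wpM2l ?(ltW t0)// /c [_ * 2]mulrAC divfK// mulrAC ler_pdivrMr//.
  by rewrite ler_wpM2l ?lerDl// ltW.
by ring.
Qed.

(** * Bounded projections and lower bounds on complements *)

Lemma closed_complement_projection {R : realType} {V : completeNormedModType R}
    {K T : set V} :
  closed_subspace K -> closed_complement K T ->
  exists P : V -> V, [/\ bounded_linear P, forall v, K (P v),
    forall k, K k -> P k = k & forall v, T (v - P v)].
Proof.
move=> cK [cT [KT0 KTV]].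
have [P PP] : {P : V -> V & forall v, K (P v) /\ T (v - P v)}.
  apply: (@choice _ _ (fun v p => K p /\ T (v - p))) => v.
  by have [s [t [Ks [Tt ->]]]] := KTV v; exists s; rewrite addrC addKr.
have PU v p : K p -> T (v - p) -> P v = p.
  move=> Kp Tp; have [KP TP] := PP v; apply/eqP; rewrite -subr_eq0; apply/eqP.
  apply: KT0; first exact: closed_subspaceB.
  have -> : P v - p = (v - p) - (v - P v) by rewrite opprB [RHS]addrC addrA subrK.
  exact: closed_subspaceB.
have Plin (a : R) u v : P (a *: u + v) = a *: P u + P v.
  have [Ku Tu] := PP u; have [Kv Tv] := PP v; apply: PU; first exact: cK.2.1.
  rewrite opprD addrACA -scalerBr; exact: cT.2.1.
exists P; split; last by move=> v; have [] := PP v.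
(* The graph is closed: in the limit the two components stay in the closed sets [K] and [T], and the
   decomposition is unique. *)
- split=> //; have [||| C _ PC] := @closed_graph R V V setT P.
  + by split=> //; split=> //; exact: closedT.
  + by [].
  + move=> u x y _ ux Pux; apply: PU.
      by apply: closed_subspace_cvg Pux => // n /=; have [] := PP (u n).
    apply: (@closed_subspace_cvg _ _ _ cT (fun n => u n - P (u n))).
      by move=> n; have [] := PP (u n).
    exact: cvgB.
  + by exists C => v; exact: PC.
- by move=> v; have [] := PP v.
- by move=> k Kk; apply: PU => //; rewrite subrr; exact: cT.1.
Qed.

(** The inverse of [f] from its closed range to [T] has a closed graph, since [f] is continuous and
    [T] closed; [c] is the inverse of its bound. *)
Lemma bounded_below_complement {R : realType} {V W : completeNormedModType R}
    {f : V -> W} {T : set V} :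
  bounded_linear f -> closed_complement [set v | f v = 0] T ->
  closed [set w | exists v, w = f v] ->
  exists2 c, 0 < c & forall v, T v -> c * `|v| <= `|f v|.
Proof.
move=> bf [cT [KT0 KTV]] cf; pose D := [set w | exists v, w = f v].
have [g gP] : {g : W -> V & forall w, D w -> T (g w) /\ f (g w) = w}.
  apply: (@choice _ _ (fun w v => D w -> T v /\ f v = w)) => w.
  have [[v ->]|] := pselect (D w); last by exists 0.
  have [s [t [/= fs [Tt ->]]]] := KTV v; exists t => _; split=> //.
  by rewrite bounded_linearD// fs add0r.
have gU w v : T v -> f v = w -> g w = v.
  move=> Tv fv; have [|Tg fg] := gP w; first by exists v.
  apply/eqP; rewrite -subr_eq0; apply/eqP.
  apply: KT0; last exact: closed_subspaceB.
  by rewrite /= bounded_linearB// fg fv subrr.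
have [||| C C0 gC] := @closed_graph R W V D g.
- split; first by exists 0; rewrite bounded_linear0.
  split=> // a _ _ [u ->] [v ->]; exists (a *: u + v); by rewrite bf.1.
- move=> a u v Du Dv; have [Tu fu] := gP _ Du; have [Tv fv] := gP _ Dv.
  by apply: gU; [exact: cT.2.1|rewrite bf.1 fu fv].
- move=> u x y Du ux gux; apply: gU.
    by apply: closed_subspace_cvg gux => // n; have [] := gP _ (Du n).
  have := bounded_linear_cvg _ bf _ _ gux.
  rewrite (_ : f \o _ = u); last by apply/funext => n /=; have [] := gP _ (Du n).
  by move=> uf; exact: (cvg_unique _ uf ux).
- exists C^-1; first by rewrite invr_gt0.
  move=> v Tv; rewrite ler_pdivrMl// -[in leLHS](gU (f v) v Tv erefl).
  by apply: gC; exists v.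
Qed.

(** * First-order behaviour of charts and tangent vectors *)

Lemma open_ball {R : realType} {V : normedModType R} {O : set V} {x : V} :
  open O -> O x -> exists2 d : R, 0 < d & forall y, `|y - x| < d -> O y.
Proof.
move=> oO Ox; have /nbhs_normP[d /= d0 H] : nbhs x O by exact: open_nbhs_nbhs.
by exists d => // y yx; apply: H; rewrite /= distrC.
Qed.

Lemma closed_adherent {R : realType} {V : normedModType R} (F : set V) (x : V) :
  closed F -> (forall e : R, 0 < e -> exists2 y, F y & `|y - x| <= e) -> F x.
Proof.
move=> cF H; apply: cF => B /nbhs_normP[d /= d0 dB].
have [|y Fy yx] := H (d / 2); first by rewrite divr_gt0.
exists y; split=> //; apply: dB => /=; rewrite distrC (le_lt_trans yx)//.
by rewrite ltr_pdivrMr// ltr_pMr// ltr1n.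
Qed.

(** The derivative is continuous because it is itself differentiable: near [z] its variation is at
    most a constant, coming from the second derivative, times [|y - z|]. *)
Lemma smooth_on_C1 {R : realType} {V W : normedModType R} {O : set V} {f : V -> W} :
  smooth_on O f -> exists Df : V -> V -> W,
    (forall z, O z -> has_frechet f z (Df z)) /\
    (forall z, O z -> forall e : R, 0 < e -> exists2 d : R, 0 < d &
       forall y, `|y - z| < d -> forall h, `|Df y h - Df z h| <= e * `|h|).
Proof.
move=> [D [D0 [Dmul DD]]].
(* Multilinear maps are fed infinite sequences here, so [h] is padded with zeros. *)
pose s (h : V) : nat -> V := consv h (fun=> 0).
have pn h : pnorm 1 (s h) = `|h| by rewrite /pnorm big_ord1.
exists (fun z h => D 1%N z (s h)); split=> z Oz.
  have [Dext [Dlin [C DC]]] := Dmul 1%N z Oz.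
  split=> [|e e0].
    split; last by exists C => h; rewrite -pn; exact: DC.
    move=> a u v; have := Dlin 0%N erefl (s 0) a u v.
    have sE h : D 1%N z (setv (s 0) 0 h) = D 1%N z (s h) by apply: Dext; case.
    by rewrite !sE.
  have [d [d0 H]] := DD 0%N z Oz e e0; exists d; split=> // h hd.
  have := H h hd (fun=> 0); rewrite !D0 /pnorm big_ord0 mulr1.
  by [].
move=> e e0; have [_ [_ [C DC]]] := Dmul 2%N z Oz.
have [d [d0 H]] := DD 1%N z Oz 1 ltr01.
have C1 : 0 < `|C| + 1 by rewrite ltr_wpDl.
exists (Num.min d (e / (`|C| + 1))); first by rewrite lt_min d0 divr_gt0.
move=> y; rewrite lt_min => /andP[yd ye] h.
have := H _ yd (s h); rewrite [z + _]addrC subrK mul1r pn => Hy.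
have := DC (consv (y - z) (s h)); rewrite /pnorm big_ord_recl big_ord1 /= => Hc.
rewrite -[X in `|X|](subrK (D 2%N z (consv (y - z) (s h)))).
rewrite (le_trans (ler_normD _ _))// (le_trans (lerD Hy Hc))//.
rewrite mulrA -mulrDl ler_wpM2r// -[X in X + _]mul1r -mulrDl.
move: ye; rewrite ltr_pdivlMr// => /ltW; rewrite mulrC; apply: le_trans.
by rewrite ler_wpM2r// addrC lerD2r ler_norm.
Qed.

Lemma norm_segment_lt {R : realType} {V : normedModType R} {q y z : V} {d t : R} :
  `|y - q| < d -> `|z - q| < d -> 0 <= t <= 1 -> `|z + t *: (y - z) - q| < d.
Proof.
move=> yd zd /andP[t0 t1].
have -> : z + t *: (y - z) - q = t *: (y - q) + (1 - t) *: (z - q).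
  rewrite scalerBl scale1r addrCA -scalerBr opprB addrA subrK.
  by rewrite addrAC.
rewrite (le_lt_trans (ler_normD _ _))// !normrZ ger0_norm// ger0_norm ?subr_ge0//.
have [->|t_neq0] := eqVneq t 0; first by rewrite mul0r add0r subr0 mul1r.
rewrite (_ : d = t * d + (1 - t) * d); last by rewrite -mulrDl addrC subrK mul1r.
by rewrite ltr_leD// ?ltr_pM2l ?lt0r ?t_neq0// ler_wpM2l ?subr_ge0// ltW.
Qed.

(** The contraction compares the inverse chart at two moving points, so the estimate must be uniform
    in both. It is the mean value inequality on a ball, with the derivative at [q] as reference. *)
Lemma strict_derivative {R : realType} {V W : normedModType R} {O : set V}
    {f : V -> W} {Df : V -> V -> W} {q : V} :
  open O -> O q -> (forall z, O z -> has_frechet f z (Df z)) ->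
  (forall e : R, 0 < e -> exists2 d : R, 0 < d &
     forall y, `|y - q| < d -> forall h, `|Df y h - Df q h| <= e * `|h|) ->
  forall e : R, 0 < e -> exists2 d : R, 0 < d &
    (forall y, `|y - q| < d -> O y) /\
    forall y z, `|y - q| < d -> `|z - q| < d ->
      `|f y - f z - Df q (y - z)| <= e * `|y - z|.
Proof.
move=> oO Oq df cDf e e0.
have [d1 d10 H1] := open_ball oO Oq; have [d2 d20 H2] := cDf e e0.
exists (Num.min d1 d2); first by rewrite lt_min d10.
split=> [y|y z yd zd]; first by rewrite lt_min => /andP[/H1].
have inb (t : R) := @norm_segment_lt _ _ q y z _ t yd zd.
have {1}-> : y = z + (y - z) by rewrite addrC subrK.
apply: mean_value_segment => t /inb; rewrite lt_min => /andP[h1 h2].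
  by apply: df; exact: H1.
exact: H2.
Qed.

Lemma has_frechet_continuous {R : realType} {V W : normedModType R} {F : V -> W}
    {x : V} {L : V -> W} : has_frechet F x L ->
  forall e : R, 0 < e -> exists2 d : R, 0 < d &
    forall h, `|h| < d -> `|F (x + h) - F x| <= e.
Proof.
move=> [bL dF] e e0; have [C C0 LC] := bounded_linear_pos _ bL.
have C1 : 0 < 1 + C by rewrite ltr_wpDl.
have [d [d0 H]] := dF 1 ltr01.
exists (Num.min d (e / (1 + C))); first by rewrite lt_min d0 divr_gt0.
move=> h; rewrite lt_min => /andP[hd he]; rewrite -[X in `|X|](subrK (L h)).
rewrite (le_trans (ler_normD _ _))// (le_trans (lerD (H _ hd) (LC h)))//.
by rewrite -mulrDl mulrC -ler_pdivlMr// ltW.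
Qed.

(** Difference quotients of [f] along the curve lie in the subspace [F], and closedness passes this
    to their limit [L v]. *)
Lemma tangent_space_frechet {R : realType} {V W : normedModType R} {S : set V}
    {O : set V} {p v : V} {f : V -> W} {L : V -> W} {F : set W} :
  open O -> O p -> S p -> has_frechet f p L -> closed_subspace F ->
  (forall x, O x -> S x -> F (f x)) -> tangent_space S p v -> F (L v).
Proof.
move=> oO Op Sp df cF OSF [r [g [r0 g0 gS /has_frechet_derive dg]]].
have [dO dO0 HO] := open_ball oO Op.
have [|dg0 dg00 cg] := has_frechet_continuous dg (dO / 2); first by rewrite divr_gt0.
rewrite -g0 in df; have [bM dfg] := has_frechet_comp dg df.
apply: closed_adherent => [|e e0]; first exact: cF.2.2.
have [d [d0 H]] := dfg e e0.
(* The three radii keep the curve in [S], keep it in [O], and control the remainder. *)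
pose t := Num.min r (Num.min dg0 d) / 2.
have m0 : 0 < Num.min r (Num.min dg0 d) by rewrite !lt_min r0 dg00.
have t0 : 0 < t by rewrite divr_gt0.
have : `|t| < Num.min r (Num.min dg0 d).
  by rewrite gtr0_norm// ltr_pdivrMr// ltr_pMr// ltr1n.
rewrite !lt_min => /andP[tr /andP[tdg td]].
exists (t^-1 *: (f (g t) - f p)).
  apply: closed_subspaceZ => //; apply: closed_subspaceB => //; last exact: OSF.
  apply: OSF; last exact: gS.
  apply: HO; have := cg _ tdg; rewrite add0r g0 => /le_lt_trans; apply.
  by rewrite ltr_pdivrMr// ltr_pMr// ltr1n.
have := H _ td; rewrite /= add0r g0 gtr0_norm// => Ht.
rewrite -(ler_pM2l t0) [leRHS]mulrC -{1}(gtr0_norm t0) -normrZ scalerBr scalerA.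
by rewrite mulfV ?gt_eqF// scale1r -(bounded_linearZ _ df.1).
Qed.

(** * Projecting a neighbourhood onto a submanifold along a complement *)

Lemma banach_fixed_point_half {R : realType} {V : completeNormedModType R}
    (S : set V) (T : V -> V) :
  closed S -> S !=set0 -> (forall k, S k -> S (T k)) ->
  (forall k l, S k -> S l -> `|T k - T l| <= 2^-1 * `|k - l|) ->
  exists2 k, S k & T k = k.
Proof.
move=> cS S0 ST Tlip.
have half0 : 0 <= 2^-1 :> R by rewrite invr_ge0.
have [k Sk kT] : exists2 k, S k & k = mkfun ST k.
  apply: banach_fixed_point => //; exists (NngNum half0); split=> /=.
    by rewrite invf_lt1 ?ltr1n.
  by move=> [k l] [/= Sk Sl]; exact: Tlip.
by exists k.
Qed.

(** The point is sought as [y = psi (q + L k)] with [k] in [K], the condition being [P (x - y) = 0].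
    The last clause quantifies over [E] because the path from [p] to [y] lives in a chart local to
    the proof. *)
Lemma submanifold_fibre {R : realType} {V : completeNormedModType R}
    (S : set V) (p : V) (K X0 : set V) :
  submanifold S -> S p -> closed_subspace K -> closed_complement K X0 ->
  K `<=` tangent_space S p ->
  forall e : R, 0 < e -> exists2 d : R, 0 < d &
    forall x, `|x - p| < d -> exists y, [/\ S y, `|y - p| < e, X0 (x - y) &
      forall E : V -> R, (forall z, S z -> has_frechet E z (fun=> 0)) -> E y = E p].
Proof.
move=> subS Sp cK compl KS e e0.
have [Om [phi [psi [F [[oO Op sphi oQ spsi] [phiK [psiK [cF [_ OSF]]]]]]]]] := subS p Sp.
have [Dphi [dphi _]] := smooth_on_C1 sphi.
have [Dpsi [dpsi cDpsi]] := smooth_on_C1 spsi.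
set Q := phi @` Om in oQ spsi psiK OSF dpsi cDpsi.
pose q := phi p; pose L := Dphi p; pose B := Dpsi q.
have Qq : Q q by exists p.
have bL : bounded_linear L := (dphi p Op).1.
have psiq : psi q = p by exact: phiK.
have BL v : B (L v) = v.
  have := has_frechet_comp (dphi p Op) (dpsi q Qq).
  move/(has_frechet_near _ id) => dBL; apply: (has_frechet_unique (dBL _)).
    by apply: filterS (open_nbhs_nbhs (conj oO Op)) => y /= /phiK.
  by apply: has_frechet_linear; split=> //; exists 1 => u; rewrite mul1r.
have phiF x : Om x -> S x -> F (phi x).
  by move=> Ox Sx; have [] : (Q `&` F) (phi x) by rewrite -OSF; exists x.
have KF k : K k -> F (L k).
  by move=> /KS; apply: tangent_space_frechet (dphi p Op) _ phiF.
have FS z : Q z -> F z -> S (psi z).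
  move=> Qz Fz; have : (Q `&` F) z by [].
  by rewrite -OSF => -[x [Ox Sx] <-]; rewrite phiK.
have [P [bP PK PkK PX0]] := closed_complement_projection cK compl.
have [CP CP0 HP] := bounded_linear_pos _ bP.
have [CL CL0 HL] := bounded_linear_pos _ bL.
have [|d1 d10 [dQ Hpsi]] := strict_derivative oQ Qq dpsi (cDpsi q Qq) ((CP * CL)^-1 / 2).
  by rewrite divr_gt0// invr_gt0 mulr_gt0.
(* Chosen so that [CP * eta * CL] is the contraction factor 1/2. *)
set eta := (CP * CL)^-1 / 2 in Hpsi.
have eta0 : 0 < eta by rewrite divr_gt0// invr_gt0 mulr_gt0.
have e1 : 0 < eta * CL + 1 by rewrite ltr_wpDl// mulr_ge0// ltW.
(* The first bound keeps [q + L k] within [d1] of [q]; the second makes [|y - p|], at most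
   [eta * CL * rho + rho], less than [e]. *)
pose rho := Num.min (d1 / CL) (e / (eta * CL + 1)) / 2.
have m0 : 0 < Num.min (d1 / CL) (e / (eta * CL + 1)) by rewrite lt_min !divr_gt0.
have rho0 : 0 < rho by rewrite divr_gt0.
have : rho < Num.min (d1 / CL) (e / (eta * CL + 1)).
  by rewrite ltr_pdivrMr// ltr_pMr// ltr1n.
rewrite lt_min !ltr_pdivlMr// => /andP[rhoL rhoe].
have ball_q k (t : R) : `|k| <= rho -> 0 <= t <= 1 -> `|q + t *: L k - q| < d1.
  move=> krho /andP[t0 t1]; rewrite addrC addKr normrZ ger0_norm//.
  rewrite (@le_lt_trans _ _ `|L k|) ?ler_piMl//.
  rewrite (le_lt_trans (HL _))// (le_lt_trans _ rhoL)// mulrC ler_wpM2r//.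
  exact: ltW.
have ball_q1 k : `|k| <= rho -> `|q + L k - q| < d1.
  by move=> krho; rewrite -[L k]scale1r ball_q// ler01 lexx.
have ball_q0 : `|q - q| < d1 by rewrite subrr normr0.
(* This gives [|T 0| <= rho / 2], so the contraction [T] below preserves the ball of radius [rho] in
   [K]. *)
exists (rho / 2 / CP); first by rewrite !divr_gt0.
move=> x xp.
(* Fixed points solve [P (x - psi (q + L k)) = 0]. Since [B] inverts [L] on the left and [P] fixes
   [K], the derivative of [T] at 0 vanishes on [K]. *)
pose T k := P (x - p) + k - P (psi (q + L k) - p).
pose U := K `&` [set k | `|k| <= rho].
have Tlip k l : U k -> U l -> `|T k - T l| <= 2^-1 * `|k - l|.
  move=> [Kk /= kr] [Kl /= lr].
  have Kkl : K (k - l) by exact: closed_subspaceB.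
  have -> : T k - T l = - P (psi (q + L k) - psi (q + L l) - B (q + L k - (q + L l))).
    have -> : q + L k - (q + L l) = L (k - l).
      by rewrite bounded_linearB// opprD addrACA subrr add0r.
    rewrite BL (bounded_linearB _ bP _ (k - l)) (PkK _ Kkl).
    have -> : psi (q + L k) - psi (q + L l) =
        (psi (q + L k) - p) - (psi (q + L l) - p).
      by rewrite opprB addrA subrK.
    rewrite (bounded_linearB _ bP (psi (q + L k) - p)) /T.
    set a := P (x - p); set b := P _; set c := P _.
    rewrite [- (a + l - c)]opprD addrACA [- (a + l)]opprD [a + k + _]addrACA.
    by rewrite subrr add0r -opprD [RHS]opprB.
  rewrite normrN (le_trans (HP _))// -ler_pdivlMl//.
  rewrite (le_trans (Hpsi _ _ (ball_q1 _ kr) (ball_q1 _ lr)))//.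
  have -> : q + L k - (q + L l) = L (k - l).
    by rewrite bounded_linearB// opprD addrACA subrr add0r.
  rewrite (le_trans (ler_wpM2l (ltW eta0) (HL _)))// le_eqVlt; apply/orP; left.
  by apply/eqP; rewrite /eta; field; rewrite !gt_eqF.
have T0 : T 0 = P (x - p).
  by rewrite /T (bounded_linear0 _ bL) !addr0 psiq subrr (bounded_linear0 _ bP) subr0.
have U0 : U 0 by split; [exact: cK.1|rewrite /= normr0 ltW].
have TU k : U k -> U (T k).
  move=> Uk; split.
    apply: closed_subspaceB => //.
    by apply: closed_subspaceD => //; case: Uk.
  have := Tlip k 0 Uk U0; rewrite /= T0 subr0 => H.
  rewrite -[T k](subrK (P (x - p))) (le_trans (ler_normD _ _))//.
  rewrite [rho in leRHS]splitr lerD//.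
    rewrite (le_trans H)// mulrC ler_wpM2r ?invr_ge0//.
    by case: Uk.
  rewrite (le_trans (HP _))// mulrC -ler_pdivlMr//.
  exact: ltW.
have [k [Kk /= krho] Tk] : exists2 k, U k & T k = k.
  apply: banach_fixed_point_half => //; last by exists 0.
  apply: closedI; first exact: cK.2.2.
  apply: (@closed_comp _ _ _ [set r : R | r <= rho]); last exact: closed_le.
  by move=> z _; exact: norm_continuous.
(* The whole segment is needed, not only its end: its image under [psi] is the path in [S] along
   which [E] is constant. *)
have QFt (t : R) : 0 <= t <= 1 -> Q (q + t *: L k) /\ F (q + t *: L k).
  move=> t01; split; first by apply: dQ; exact: ball_q.
  apply: closed_subspaceD => //; first exact: phiF.
  by apply: closed_subspaceZ => //; exact: KF.
have [Q1 F1] : Q (q + L k) /\ F (q + L k).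
  by rewrite -[L k]scale1r; apply: QFt; rewrite ler01 lexx.
exists (psi (q + L k)); split.
- exact: FS.
- have := Hpsi _ _ (ball_q1 _ krho) ball_q0; rewrite psiq.
  have -> : q + L k - q = L k by rewrite addrC addKr.
  rewrite -/B BL => H.
  rewrite -[X in `|X|](subrK k) (le_lt_trans (ler_normD _ _))//.
  rewrite (@le_lt_trans _ _ (rho * (eta * CL + 1)))// mulrDr mulr1 lerD//.
  rewrite (le_trans H)// mulrCA ler_wpM2l ?(ltW eta0)//.
  rewrite (le_trans (HL _))// mulrC ler_wpM2r//.
  exact: ltW.
- suff Px : P (x - psi (q + L k)) = 0.
    by have := PX0 (x - psi (q + L k)); rewrite Px subr0.
  move: Tk; rewrite /T => /eqP; rewrite -subr_eq0 addrAC addrK -bounded_linearB//.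
  by rewrite opprB addrA subrK => /eqP ->.
- move=> E dE; apply/eqP; rewrite -subr_eq0 -normr_le0 -[_ - _]subr0.
  have -> : E p = E (psi q) by rewrite psiq.
  apply: (@mean_value_segment _ _ _ (E \o psi) (fun z => (fun=> 0) \o Dpsi z)).
    move=> t /QFt[Qt Ft]; apply: has_frechet_comp; first exact: dpsi.
    by apply: dE; exact: FS.
  by move=> t _ /=; rewrite subr0 normr0.
Qed.

(** * The Hessian kernel and the gradient inequality *)

Lemma closed_subspace_bilinear_kernel {R : realType} {V : normedModType R}
    (B : V -> V -> R) :
  bounded_bilinear B -> closed_subspace [set v | forall w, B v w = 0].
Proof.
move=> [_ [Blin [C BC]]].
have B0 w : B 0 w = 0.
  have := Blin 1 0 0 w; rewrite scaler0 add0r mul1r => /(congr1 (fun r => r - B 0 w)).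
  by rewrite subrr addrK.
split; first exact: B0.
split=> [a u v Bu Bv w|]; first by rewrite Blin Bu Bv mulr0 addr0.
move=> v clv w; apply/eqP; rewrite -normr_le0; apply/ler_addgt0Pr => e e0.
have Cw : 0 < `|C| * `|w| + 1 by rewrite ltr_wpDl// mulr_ge0.
have [u [/= Bu uv]] : [set v | forall w, B v w = 0] `&`
    [set u | `|v - u| < e / (`|C| * `|w| + 1)] !=set0.
  apply: clv; apply/nbhs_normP; exists (e / (`|C| * `|w| + 1)) => //=.
  by rewrite divr_gt0.
have -> : B v w = B (v - u) w.
  by have := Blin 1 (v - u) u w; rewrite scale1r subrK mul1r Bu addr0.
rewrite add0r (le_trans (BC _ _))//.
move: uv => /ltW; rewrite ler_pdivlMr//; apply: le_trans.
rewrite mulrAC [leRHS]mulrC ler_wpM2r//.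
by rewrite (@le_trans _ _ (`|C| * `|w|)) ?ler_wpM2r ?ler_norm// lerDl.
Qed.

Theorem theorem3 (R : realType)
  (X Y G H : completeNormedModType R)
  (iXG : X -> G) (iYH : Y -> H) (jHG : H -> G -> R)
  (U : set X) (E : X -> R) (E2 : X -> X -> X -> R) (xinf : X)
  (M : X -> Y) (M1 : X -> G -> H) (X0 : set X) (G0 : set G) :
  (* continuous embeddings  X ⊂ G  and  Y ⊂ H ⊂ G^* ⊂ X^* *)
  embedding iXG ->
  embedding iYH ->
  (forall h, bounded_linear (jHG h)) ->
  (forall (a : R) h k g, jHG (a *: h + k) g = a * jHG h g + jHG k g) ->
  (exists C : R, forall h g, `|jHG h g| <= C * `|h| * `|g|) ->
  (forall h, (forall g, jHG h g = 0) -> h = 0) ->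
  (forall phi : G -> R, bounded_linear phi ->
     (forall x, phi (iXG x) = 0) -> forall g, phi g = 0) ->
  (* U open, E of class C^2 on U with Hessian E2 *)
  open U ->
  (forall x, U x -> differentiable E x) ->
  (forall x, U x -> bounded_bilinear (E2 x)) ->
  bil_deriv_on U (fun x v => 'd E x v) E2 ->
  bil_cont_on U E2 ->
  (* x_inf a critical point *)
  U xinf ->
  (forall v, 'd E xinf v = 0) ->
  (* M a C^1 gradient map for E *)
  (forall x, U x -> differentiable M x) ->
  opcont_on U (fun x v => 'd M x v) ->
  (forall x v, U x -> 'd E x v = jHG (iYH (M x)) (iXG v)) ->
  (* E Morse-Bott at x_inf *)
  (exists U' : set X, [/\ open U', U' xinf, U' `<=` U,
     submanifold (U' `&` [set x | U x /\ forall v, 'd E x v = 0]) &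
     tangent_space (U' `&` [set x | U x /\ forall v, 'd E x v = 0]) xinf
       = [set v | forall w, E2 xinf v w = 0]]) ->
  (* extensions M1(x) : G -> H of M'(x), continuous in L(G,H) *)
  (forall x, U x -> bounded_linear (M1 x)) ->
  (forall x v, U x -> M1 x (iXG v) = iYH ('d M x v)) ->
  opcont_on U M1 ->
  (* complements and closed range *)
  closed_complement [set v | forall w, E2 xinf v w = 0] X0 ->
  closed_complement [set g | M1 xinf g = 0] G0 ->
  (forall x, X0 x -> G0 (iXG x)) ->
  closed [set h | exists g, h = M1 xinf g] ->
  exists Z sigma : R, [/\ 0 < Z, 0 < sigma, sigma <= 1 &
    forall x, U x -> `|x - xinf| < sigma ->
      `|iYH (M x)| >= Z * Num.sqrt `|E x - E xinf| ].
Proof.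
move=> [biX _] [biY _] bj jlin [Cj0 jC] jinj dens oU dE bE2 _ _ Up dEp dM _ grad.
move=> [U' [oU' U'p U'U subS tanS]] bM1 M1M cM1 complK complG X0G0 cran.
set p := xinf in Up dEp U'p tanS complK complG cran *.
have cK := closed_subspace_bilinear_kernel _ (bE2 p Up).
have Sp : (U' `&` [set x | U x /\ forall v, 'd E x v = 0]) p by [].
have [c c0 cG0] := bounded_below_complement (bM1 p Up) complG cran.
have [A A0 HA] := bounded_linear_pos _ (bM1 p Up).
have c20 : 0 < c / 2 by rewrite divr_gt0.
have [d1 [d10 Hd1]] := cM1 p Up (c / 2) c20.
have [d2 d20 Hd2] := open_ball oU Up.
(* On this ball around [p], contained in [U], [M1] stays within [c / 2] of [M1 p]; both [x] and [y]
   will lie in it, hence so will their segment. *)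
have d0 : 0 < Num.min d1 d2 by rewrite lt_min d10.
have fibre := submanifold_fibre _ _ _ _ subS Sp cK complK.
have {fibre}[|d3 d30 fibre] := fibre _ _ d0; first by rewrite tanS.
pose Cj := `|Cj0| + 1.
have Cj_gt0 : 0 < Cj by rewrite ltr_wpDl.
have Ac : 0 < A + c / 2 by rewrite addr_gt0.
pose D := Cj * (A + c / 2).
have D0 : 0 < D by rewrite mulr_gt0.
have sD0 : 0 < Num.sqrt D by rewrite sqrtr_gt0.
(* [Z] combines [c / 2 * |g| <= |N x|] with [|E x - E p| <= D * |g| ^+ 2]. *)
exists (c / 2 / Num.sqrt D), (Num.min 1 (Num.min d3 (Num.min d1 d2))).
split; [by rewrite divr_gt0|by rewrite !lt_min ltr01 d30 d10|by rewrite ge_min lexx|].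
move=> x Ux; rewrite lt_min => /andP[_]; rewrite lt_min => /andP[/fibre + xd].
move=> [y [[U'y [Uy dEy]] yd X0w Ey]].
pose N z := iYH (M z); pose w := x - y; pose g := iXG w.
have xE : x = y + w by rewrite /w addrC subrK.
(* Criticality only kills the functional [jHG (N y)] on the image of [X]; injectivity of the
   restriction from the dual of [G] to that of [X], then of [jHG], gives [N y = 0]. *)
have Ny : N y = 0.
  apply: jinj; apply: (dens (jHG (N y))); first exact: bj.
  by move=> v; rewrite -grad// dEy.
have seg (t : R) : 0 <= t <= 1 ->
    U (y + t *: w) /\ forall u, `|M1 (y + t *: w) u - M1 p u| <= c / 2 * `|u|.
  move=> t01; have := norm_segment_lt xd yd t01; rewrite lt_min => /andP[h1 h2].
  have Uz := Hd2 _ h2; split=> // u.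
  exact: Hd1.
have dN z : U z -> has_frechet N z (iYH \o 'd M z).
  move=> Uz; apply: (has_frechet_comp (has_frechet_diff _ _ (dM z Uz))).
  exact: has_frechet_linear.
(* The case [s = 1] serves the lower bound for [N x]; the other values bound the gradient along the
   segment. *)
have linN (s : R) : 0 <= s <= 1 ->
    `|N (y + s *: w) - M1 p (iXG (s *: w))| <= c / 2 * `|iXG (s *: w)|.
  move=> /andP[s0 s1]; rewrite -[N _]subr0 -Ny.
  apply: (@mean_value_segment _ _ _ N (fun z => iYH \o 'd M z)) => t /andP[t0 t1].
    apply: dN; rewrite scalerA; apply: (seg _ _).1.
    by rewrite mulr_ge0//= mulr_ile1.
  have [|Uz Hz] := seg (t * s); first by rewrite mulr_ge0//= mulr_ile1.
  by rewrite /= -M1M scalerA.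
(* Half of the lower bound [c] of [M1 p] on [G0] survives the linearization error. *)
have Nx : c / 2 * `|g| <= `|N x|.
  have := linN 1; rewrite ler01 lexx scale1r -xE => /(_ isT) lin1.
  have := cG0 g (X0G0 _ X0w); have := ler_distD (N x) (M1 p g) 0.
  rewrite !subr0 distrC; move: lin1; rewrite -/g.
  set a := `|_ - _|; set b := `|M1 p g|; set n := `|N x|.
  by move=> ? ? ?; lra.
have Nseg (t : R) : 0 <= t <= 1 -> `|N (y + t *: w)| <= (A + c / 2) * `|g|.
  move=> t01; have := linN t t01; have /andP[t0 t1] := t01.
  have tg : `|iXG (t *: w)| <= `|g|.
    by rewrite (bounded_linearZ _ biX) normrZ ger0_norm// ler_piMl.
  move=> lint; rewrite -[N _](subrK (M1 p (iXG (t *: w)))).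
  rewrite (le_trans (ler_normD _ _))// addrC mulrDl lerD//.
    by rewrite (le_trans (HA _))// ler_wpM2l// ltW.
  by rewrite (le_trans lint)// ler_wpM2l// ltW.
have jC' h k : `|jHG h k| <= Cj * `|h| * `|k|.
  rewrite (le_trans (jC _ _))// ler_wpM2r// ler_wpM2r//.
  by rewrite (le_trans (ler_norm _))// lerDl.
have Ex : `|E x - E p| <= D * `|g| ^+ 2.
  rewrite -Ey; last first.
    move=> z [_ [Uz dEz]]; have := has_frechet_diff _ _ (dE z Uz).
    by congr has_frechet; apply/funext => v.
  rewrite xE -[X in `|X|]subr0.
  apply: (@mean_value_segment _ _ _ E (fun z => 'd E z)) => t t01.
    by apply: has_frechet_diff; apply: dE; have [] := seg t t01.
  (* One factor [|g|] comes from the gradient, which vanishes at [y], the other from pairing it with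
     [w]. *)
  have [Uz _] := seg t t01; rewrite subr0 grad// (le_trans (jC' _ _))//.
  rewrite expr2 mulrA ler_wpM2r// /D -mulrA ler_wpM2l ?(ltW Cj_gt0)//.
  exact: Nseg.
rewrite mulrAC ler_pdivrMr// (@le_trans _ _ (c / 2 * (Num.sqrt D * `|g|)))//.
  rewrite ler_wpM2l ?(ltW c20)//.
  have -> : Num.sqrt D * `|g| = Num.sqrt (D * `|g| ^+ 2).
    by rewrite [RHS]sqrtrM ?(ltW D0)// sqrtr_sqr normr_id.
  exact: ler_wsqrtr.
by rewrite mulrCA mulrC ler_wpM2r// ltW.
Qed.
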